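(* Let $\{(\theta_t,r_t,m_t)\}_{t\ge0}$ be generated by AEGDM in the stochastic setting (defined in the context) with step size $\eta>0$ and momentum parameter $\mu$. Then AEGDM is unconditionally energy stable in the sense that, for any step size $\eta>0$ and each $i\in\{1,\dots,n\}$, $\mathbb{E}[r_{t,i}]$ is strictly decreasing in $t$ and convergent, with $\mathbb{E}[r_{t,i}]\to r_i^*$ as $t\to\infty$. Moreover: (i) for any $0\le\mu<1$ and $\eta>0$, $$\lim_{t\to\infty}\mathbb{E}[\|\theta_{t+1}-\theta_t\|]=0,\qquad \sum_{t=0}^\infty\mathbb{E}[\|\theta_{t+1}-\theta_t\|^2]\le\frac{2\eta n}{(1-\mu)^2}\,(f(\theta_0)+c);$$ (ii) for any $\eta>0$, every integer $T\ge1$ and every $i\in\{1,\dots,n\}$, $$\frac1T\sum_{t=0}^{T-1}\mathbb{E}[|v_{t,i}|]\le\left(\frac{\sqrt{f(\theta_0)+c}}{2}\right)^{1/2}\left(\mathbb{E}\left[\frac{1}{\eta\,T\,r_{T,i}}\right]\right)^{1/2}.$$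
   Context: Stochastic setting: $\xi$ is a random variable; for each value of $\xi$, $f(\cdot;\xi):\mathbb{R}^n\to\mathbb{R}$ is differentiable (possibly nonconvex) and bounded from below, and $c$ is a constant with $f(\theta;\xi)+c>0$ for all $\theta$ and $\xi$. Put $f(\theta)=\mathbb{E}_\xi[f(\theta;\xi)]$. Let $\xi_0,\xi_1,\dots$ be random samples, each with the distribution of $\xi$, and set $f_t(\theta)=f(\theta;\xi_t)$. The initial point $\theta_0\in\mathbb{R}^n$ is deterministic. $\|\cdot\|$ is the Euclidean norm, $\partial_i$ is the $i$-th partial derivative in $\theta$, and $\mathbb{E}$ is expectation over all samples. AEGDM with step size $\eta$ and momentum parameter $\mu$ is the iteration, for $t\ge0$ and $i\in\{1,\dots,n\}$, $$v_{t,i}=\frac{\partial_i f(\theta_t;\xi_t)}{2\sqrt{f(\theta_t;\xi_t)+c}},\qquad m_{t+1,i}=\mu m_{t,i}+v_{t,i},\quad m_{0,i}=0,$$ $$r_{t+1,i}=\frac{r_{t,i}}{1+2\eta v_{t,i}^2},\quad r_{0,i}=\sqrt{f(\theta_0;\xi_0)+c},\qquad \theta_{t+1,i}=\theta_{t,i}-2\eta\, r_{t+1,i}m_{t+1,i}.$$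
   Formalization: Strict decrease of E[r_{t,i}] fails as stated (e.g. f = 0, c = 1 gives constant r); what is proved is that E[r_{t,i}] is nonincreasing for all t and strictly decreases at each step t where v_{t,i} is not almost surely zero. *)

(* Defs.v *)
From HB Require Import structures.
From mathcomp Require Import all_boot all_order all_algebra.
From mathcomp Require Import all_classical all_reals all_analysis.

Set Implicit Arguments.
Unset Strict Implicit.
Unset Printing Implicit Defensive.

Import Order.TTheory GRing.Theory Num.Theory.
Import numFieldNormedType.Exports.

Local Open Scope classical_set_scope.
Local Open Scope ring_scope.

(* The norm `|x| on 'rV[R]_n provided by the library is the sup norm. *)
Definition enorm (R : realType) (n : nat) (x : 'rV[R]_n) : R :=
  Num.sqrt (\sum_(i < n) x 0 i ^+ 2).

Definition partial (R : realType) (n : nat) (g : 'rV[R]_n -> R) (i : 'I_n)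
    (x : 'rV[R]_n) : R :=
  'D_(delta_mx 0 i) g x.

(* One run of the method: g t is the sampled objective f(.; xi_t).  The momentum
   and energy updates are coordinatewise; v t is the transformed gradient, i.e.
   the gradient of Num.sqrt (g t + c) at theta t. *)
Record aegdm (R : realType) (n : nat) (g : nat -> 'rV[R]_n -> R)
    (c eta mu : R) (theta0 : 'rV[R]_n)
    (theta r m v : nat -> 'rV[R]_n) : Prop := Aegdm {
  aegdm_theta0 : theta 0%N = theta0 ;
  aegdm_r0 : forall i, r 0%N 0 i = Num.sqrt (g 0%N theta0 + c) ;
  aegdm_m0 : forall i, m 0%N 0 i = 0 ;
  aegdm_v : forall t i, v t 0 i =
    partial (g t) i (theta t) / (2 * Num.sqrt (g t (theta t) + c)) ;
  aegdm_mS : forall t i, m t.+1 0 i = mu * m t 0 i + v t 0 i ;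
  aegdm_rS : forall t i, r t.+1 0 i = r t 0 i / (1 + 2 * eta * v t 0 i ^+ 2) ;
  aegdm_thetaS : forall t i,
    theta t.+1 0 i = theta t 0 i - 2 * eta * r t.+1 0 i * m t.+1 0 i }.

Definition mean_objective (R : realType) (d d' : measure_display)
    (Om : measurableType d) (Xi : measurableType d') (P : probability Om R)
    (xi : {RV P >-> Xi}) (n : nat) (f : 'rV[R]_n -> Xi -> R)
    (x : 'rV[R]_n) : R :=
  fine ('E_P[fun w => f x (xi w)])%E.

(* Main.v *)
Require Import Defs.
From HB Require Import structures.
From mathcomp Require Import all_boot all_order all_algebra.
From mathcomp Require Import all_classical all_reals all_analysis.
From mathcomp Require Import measurable_realfun ring lra.

(** Everything is driven by one identity, valid along every trajectory and in
every coordinate: the energy update rearranges to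
r_t - r_(t+1) = 2 eta v_t^2 r_(t+1).  Hence the energies are positive and
nonincreasing whatever the step size, and the squared gradients, suitably
weighted by energies, have bounded sums because the energy drops telescope.

Expected energies are therefore nonincreasing and nonnegative, so they
converge; the drop at time t has zero mean only if it vanishes almost surely,
that is, only if v_t does.

For the displacements, which are 2 eta r_(t+1) m_(t+1) up to sign, convexity
of the square gives m_(t+1)^2 <= mu m_t^2 + v_t^2 / (1 - mu).  Weighting this
by r_(t+1)^2 <= r_t^2 and paying for the gradient term with the energy drop
yields a nonincreasing potential, a nonnegative combination of past squared
displacements, the current (r_t m_t)^2 and the current energy
([energy_displacement_sum]).  The squared displacements of one coordinate
therefore sum to at most 2 eta / (1 - mu)^2 r_0^2, where
r_0^2 = f(theta_0; xi_0) + c has expectation f(theta_0) + c because xi_0 is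
distributed as xi.  The general term of a convergent series tends to 0, and
E|X| <= (E X^2)^(1/2) passes from squared displacements to displacements.

For the averages of |v_t|, the identity gives v_t^2 <= (r_t - r_(t+1)) /
(2 eta r_T) for t < T; the finite Cauchy-Schwarz inequality then bounds the
average by (r_0 / 2)^(1/2) (1 / (eta T r_T))^(1/2)
([energy_gradient_mean]), and the Cauchy-Schwarz inequality for expectations
separates the two factors.  It holds also when 1 / r_T has infinite
expectation.

Taking expectations requires the iterates to be random variables.  The
objective is continuous in the parameter and measurable in the sample, so it
stays measurable when a random parameter is substituted
([measurable_fun_caratheodory]), and so do its partial derivatives, being
limits of difference quotients ([measurable_fun_partial]). *)

Set Implicit Arguments.
Unset Strict Implicit.
Unset Printing Implicit Defensive.

Import Order.TTheory GRing.Theory Num.Theory.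
Import numFieldNormedType.Exports.

Local Open Scope classical_set_scope.
Local Open Scope ring_scope.

(** * Energy recursion along one trajectory, coordinate by coordinate *)

Definition energy_recursion (R : realType) (eta : R) (v r : nat -> R) : Prop :=
  0 < r 0%N /\ forall t, r t.+1 = r t / (1 + 2 * eta * v t ^+ 2).

Lemma energy_factor_ge1 (R : realType) (eta x : R) :
  0 < eta -> 1 <= 1 + 2 * eta * x ^+ 2.
Proof. by move=> e0; rewrite lerDl mulr_ge0 ?sqr_ge0// mulr_ge0// ltW. Qed.

Lemma energy_gt0 (R : realType) (eta : R) (v r : nat -> R) t :
  0 < eta -> energy_recursion eta v r -> 0 < r t.
Proof.
move=> e0 [r0 rS]; elim: t => [//|t IH].
by rewrite rS divr_gt0//; exact: lt_le_trans ltr01 (energy_factor_ge1 _ e0).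
Qed.

(** The source of every estimate: squared gradients, weighted by the energy,
are telescoping differences. *)
Lemma energy_drop (R : realType) (eta : R) (v r : nat -> R) t :
  0 < eta -> energy_recursion eta v r ->
  r t - r t.+1 = 2 * eta * v t ^+ 2 * r t.+1.
Proof.
move=> e0 [_ rS].
have : 1 + 2 * eta * v t ^+ 2 != 0.
  by rewrite gt_eqF//; exact: lt_le_trans ltr01 (energy_factor_ge1 _ e0).
move: (rS t) => -> h; rewrite -[X in X - _](divfK h); ring.
Qed.

Lemma energy_nonincreasing (R : realType) (eta : R) (v r : nat -> R) :
  0 < eta -> energy_recursion eta v r -> forall s t, (s <= t)%N -> r t <= r s.
Proof.
move=> e0 er; apply/nonincreasing_seqP => t; rewrite -subr_ge0.
have rt1 := energy_gt0 t.+1 e0 er.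
rewrite (energy_drop t e0 er).
apply: mulr_ge0 (ltW rt1); apply: mulr_ge0 (sqr_ge0 _).
by rewrite mulr_ge0 ?ltW.
Qed.

(** The momentum is a geometric convolution of the past gradients.  Rather than
expand it and exchange a double sum, the proof tracks a potential in which a
fraction mu of each displacement is carried over to the next step. *)
Lemma energy_displacement_sum (R : realType) (eta mu : R) (v r m : nat -> R) N :
  0 < eta -> 0 <= mu < 1 -> energy_recursion eta v r ->
  m 0%N = 0 -> (forall t, m t.+1 = mu * m t + v t) ->
  \sum_(0 <= t < N) (2 * eta * r t.+1 * m t.+1) ^+ 2 <=
    2 * eta / (1 - mu) ^+ 2 * r 0%N ^+ 2.
Proof.
move=> e0 /andP[mu0 mu1] er m0 mS.
have q0 : 0 < 1 - mu by rewrite subr_gt0.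
set x := fun t => (r t * m t) ^+ 2.
have xS t : x t.+1 <= mu * x t + (r t.+1 * v t) ^+ 2 / (1 - mu).
  have rt1 := energy_gt0 t.+1 e0 er.
  have rle : r t.+1 ^+ 2 <= r t ^+ 2.
    by rewrite ler_sqr ?nnegrE ?(energy_nonincreasing e0 er)// ltW//
      (energy_gt0 _ e0 er).
  (* Jensen for m_(t+1) = mu m_t + (1 - mu) (v_t / (1 - mu)). *)
  have cvx : m t.+1 ^+ 2 <= mu * m t ^+ 2 + v t ^+ 2 / (1 - mu).
    rewrite -subr_ge0 mS.
    have -> : mu * m t ^+ 2 + v t ^+ 2 / (1 - mu) - (mu * m t + v t) ^+ 2 =
        mu * ((1 - mu) * m t - v t) ^+ 2 / (1 - mu).
      by field; rewrite gt_eqF.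
    by rewrite divr_ge0 ?(mulr_ge0 mu0 (sqr_ge0 _)) ?(ltW q0).
  rewrite /x !exprMn; apply: le_trans (ler_wpM2l (sqr_ge0 _) cvx) _.
  have := ler_wpM2r (mulr_ge0 mu0 (sqr_ge0 (m t))) rle; lra.
have rv t : (r t.+1 * v t) ^+ 2 <= r 0%N / (2 * eta) * (r t - r t.+1).
  rewrite (energy_drop t e0 er).
  have -> : r 0%N / (2 * eta) * (2 * eta * v t ^+ 2 * r t.+1) =
      r 0%N * (v t ^+ 2 * r t.+1) by field; rewrite gt_eqF.
  rewrite exprMn expr2 -mulrA [r t.+1 * v t ^+ 2]mulrC.
  have rt1 := energy_gt0 t.+1 e0 er.
  rewrite ler_wpM2r ?(energy_nonincreasing e0 er)//.
  by rewrite mulr_ge0 ?sqr_ge0 ?(ltW rt1).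
(* The term mu x_T is what xS carries over to the next step; rv pays for the
   gradient term of xS with a drop of the energy. *)
have pot T : (1 - mu) * (\sum_(0 <= t < T) x t.+1) + mu * x T +
    r 0%N / (2 * eta) * r T / (1 - mu) <=
    r 0%N / (2 * eta) * r 0%N / (1 - mu).
  elim: T => [|T IH].
    by rewrite big_nil /x m0 !mulr0 expr0n /= mulr0 !add0r.
  apply: le_trans IH; rewrite big_nat_recr//=.
  have h1 : (r T.+1 * v T) ^+ 2 / (1 - mu) <=
      r 0%N / (2 * eta) * (r T - r T.+1) / (1 - mu).
    by rewrite ler_pM2r ?invr_gt0.
  have := xS T; move: h1; rewrite mulrBr mulrBl; lra.
have main : \sum_(0 <= t < N) x t.+1 <=
    r 0%N ^+ 2 / (2 * eta) / (1 - mu) ^+ 2.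
  rewrite -(ler_pM2l q0).
  have -> : (1 - mu) * (r 0%N ^+ 2 / (2 * eta) / (1 - mu) ^+ 2) =
      r 0%N / (2 * eta) * r 0%N / (1 - mu).
    by field; rewrite !gt_eqF.
  apply: le_trans (pot N); rewrite -addrA lerDl addr_ge0//.
    by rewrite mulr_ge0 ?sqr_ge0.
  by rewrite !mulr_ge0 ?invr_ge0// ?mulr_ge0// ltW// (energy_gt0 _ e0 er).
have -> : \sum_(0 <= t < N) (2 * eta * r t.+1 * m t.+1) ^+ 2 =
    (2 * eta) ^+ 2 * \sum_(0 <= t < N) x t.+1.
  by rewrite big_distrr/=; apply: eq_bigr => t _; rewrite /x; ring.
apply: le_trans (ler_wpM2l (sqr_ge0 _) main) _.
by rewrite le_eqVlt; apply/orP; left; apply/eqP; field; rewrite !gt_eqF.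
Qed.

(** Cauchy-Schwarz against the constant sequence 1; the induction step, once
multiplied by the number K of terms, reduces to (S - K a)^2 >= 0.  Dividing by
K back requires K > 0, hence the separate treatment of the first term. *)
Lemma sqr_sum_le (R : realType) (a : nat -> R) N :
  (\sum_(0 <= t < N) a t) ^+ 2 <= N%:R * \sum_(0 <= t < N) a t ^+ 2.
Proof.
elim: N => [|N]; first by rewrite !big_nil expr0n mul0r.
rewrite !big_nat_recr//=.
set S := \sum_(0 <= t < N) _; set Q := \sum_(0 <= t < N) _.
case: N @S @Q => [|N] S Q IH.
  by rewrite /S /Q !big_nil !add0r mul1r.
set K := N.+1%:R in IH *.
have K0 : 0 < K :> R by rewrite ltr0n.
rewrite -(natr1 N.+1) -/K -subr_ge0 -(pmulr_rge0 _ K0).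
have -> : K * ((K + 1) * (Q + a N.+1 ^+ 2) - (S + a N.+1) ^+ 2) =
    (K + 1) * (K * Q - S ^+ 2) + (S - K * a N.+1) ^+ 2 by ring.
by rewrite addr_ge0 ?sqr_ge0// mulr_ge0 ?subr_ge0// addr_ge0// ltW.
Qed.

(** Since the energy decreases, the weight r_(t+1) of v_t^2 in the energy drop
can be replaced by the final energy r_N, after which the drops telescope. *)
Lemma energy_gradient_mean (R : realType) (eta : R) (v r : nat -> R) N :
  0 < eta -> energy_recursion eta v r -> (1 <= N)%N ->
  N%:R^-1 * \sum_(0 <= t < N) `|v t| <=
    Num.sqrt (r 0%N / 2) * Num.sqrt (1 / (eta * N%:R * r N)).
Proof.
move=> e0 er N1.
have rN := energy_gt0 N e0 er; have r0 := energy_gt0 0 e0 er.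
have K0 : 0 < N%:R :> R by rewrite ltr0n.
have sumv : \sum_(0 <= t < N) `|v t| ^+ 2 <= r 0%N / (2 * eta * r N).
  rewrite ler_pdivlMr ?mulr_gt0//.
  have : \sum_(0 <= t < N) `|v t| ^+ 2 * (2 * eta * r N) <=
      \sum_(0 <= t < N) (r t - r t.+1).
    rewrite !big_nat; apply: ler_sum => t /andP[_ tN].
    rewrite (energy_drop t e0 er) real_normK ?num_real//.
    have g : 0 <= 2 * eta * v t ^+ 2.
      by apply: mulr_ge0 (sqr_ge0 _); rewrite mulr_ge0 ?ltW.
    have := ler_wpM2l g (energy_nonincreasing e0 er tN); lra.
  rewrite (@telescope_sumr_eq _ 0 N (fun t => - r t) (fun t => r t - r t.+1))//.
    rewrite -big_distrl/= => h; apply: le_trans h _; lra.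
  by move=> t _; rewrite opprK addrC.
rewrite -sqrtrM; last by rewrite divr_ge0// ltW.
have M0 : 0 <= N%:R^-1 * \sum_(0 <= t < N) `|v t|.
  by rewrite mulr_ge0 ?invr_ge0// sumr_ge0.
rewrite -(ger0_norm M0) -sqrtr_sqr ler_wsqrtr// exprMn.
apply: le_trans (ler_wpM2l (sqr_ge0 _) (sqr_sum_le _ _)) _.
apply: (@le_trans _ _ (N%:R^-1 ^+ 2 * (N%:R * (r 0%N / (2 * eta * r N))))).
  by rewrite ler_wpM2l ?sqr_ge0// ler_wpM2l.
by rewrite le_eqVlt; apply/orP; left; apply/eqP; field; rewrite !gt_eqF.
Qed.

(** * Measurability under substitution of a random parameter *)

Lemma measurable_fun_countable_param d (T : measurableType d) (R : realType)
    (Q : countType) (q : T -> Q) (h : Q -> T -> R) :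
  (forall a, measurable (q @^-1` [set a])) ->
  (forall a, measurable_fun [set: T] (h a)) ->
  measurable_fun [set: T] (fun w => h (q w) w).
Proof.
move=> mq mh _ Y mY; rewrite setTI.
have -> : (fun w => h (q w) w) @^-1` Y =
    \bigcup_a (q @^-1` [set a] `&` (h a @^-1` Y)).
  apply/seteqP; split=> [w Yw|w [a _ [/= <-]]//]; by exists (q w).
apply: countable_bigcupT_measurable => // a; apply: measurableI => //.
by rewrite -[X in measurable X]setTI; exact: mh.
Qed.

Lemma measurable_floor_preimage d (T : measurableType d) (R : realType)
    (h : T -> R) (z : int) :
  measurable_fun [set: T] h ->
  measurable ((fun w => Num.floor (h w)) @^-1` [set z]).
Proof.
move=> mh.
have -> : (fun w => Num.floor (h w)) @^-1` [set z] =
    [set: T] `&` h @^-1` `[z%:~R, (z + 1)%:~R[%classic.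
  rewrite setTI; apply/seteqP; split=> w /=; rewrite in_itv/=.
    by move=> <-; exact: floor_itv.
  by rewrite -floor_eq => /eqP.
by apply: mh => //; exact: measurable_itv.
Qed.

Lemma cvg_grid (R : realType) n (x : 'rV[R]_n) :
  (\row_i ((Num.floor (k.+1%:R * x 0 i))%:~R / k.+1%:R)) @[k --> \oo] --> x.
Proof.
apply/cvgrPdist_le => e e0.
have /cvgrPdist_le/(_ _ e0) := @cvg_harmonic R.
apply: filterS => k; rewrite sub0r normrN /= ger0_norm// => ke.
rewrite /Num.norm/= mx_normrE bigmax_le// ?(ltW e0)// => -[a i] _ /=.
apply: le_trans ke; rewrite (ord1 a) !mxE.
have k0 : 0 < k.+1%:R :> R by rewrite ltr0n.
have /andP[h1 h2] := floor_itv (k.+1%:R * x 0 i).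
rewrite intrD rmorph1 in h2.
move: h1 h2; set u : R := _%:~R => h1 h2.
have -> : x 0 i - u / k.+1%:R = (k.+1%:R * x 0 i - u) / k.+1%:R.
  by field; rewrite gt_eqF.
rewrite normrM (ger0_norm (_ : 0 <= k.+1%:R^-1)) ?invr_ge0//.
by rewrite ler_piMl ?invr_ge0// ger0_norm; lra.
Qed.

(** A function continuous in x and measurable in s need only be evaluated at
the grid points of mesh 1 / (k + 1): rounding the random parameter down to the
grid leaves countably many values, each giving a measurable function, and
continuity recovers the value at the parameter as k grows. *)
Lemma measurable_fun_caratheodory d d' (T : measurableType d)
    (Xi : measurableType d') (R : realType) n (g : 'rV[R]_n -> Xi -> R)
    (X : T -> 'rV[R]_n) (Z : T -> Xi) :
  (forall s, continuous (g^~ s)) ->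
  (forall x, measurable_fun [set: Xi] (g x)) ->
  (forall i, measurable_fun [set: T] (fun w => X w 0 i)) ->
  measurable_fun [set: T] Z ->
  measurable_fun [set: T] (fun w => g (X w) (Z w)).
Proof.
move=> gc gm mX mZ.
pose q (k : nat) (w : T) : 'rV[int]_n :=
  \row_i Num.floor (k.+1%:R * X w 0 i).
pose p (k : nat) (z : 'rV[int]_n) : 'rV[R]_n :=
  \row_i ((z 0 i)%:~R / k.+1%:R).
apply: (@measurable_fun_cvg _ _ _ _ (fun k w => g (p k (q k w)) (Z w))).
  move=> k; apply: (@measurable_fun_countable_param _ _ _ _ (q k)
    (fun z w => g (p k z) (Z w))).
    move=> z.
    have -> : q k @^-1` [set z] = \bigcap_i
        ((fun w => Num.floor (k.+1%:R * X w 0 i)) @^-1` [set z 0 i]).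
      apply/seteqP; split=> w /=.
        by move=> <- i _; rewrite /q /= mxE.
      by move=> h; apply/rowP => i; rewrite mxE; exact: h.
    apply: fin_bigcap_measurable => // i _.
    apply: measurable_floor_preimage; exact: measurable_funM.
  by move=> z; apply: measurableT_comp.
move=> w _.
have grid : (fun k => p k (q k w)) @ \oo --> X w.
  suff -> : (fun k => p k (q k w)) =
      (fun k => \row_i ((Num.floor (k.+1%:R * X w 0 i))%:~R / k.+1%:R)).
    exact: cvg_grid.
  by apply/funext => k; apply/rowP => i; rewrite !mxE.
exact: (cvg_comp _ _ grid (gc (Z w) (X w))).
Qed.

(** A partial derivative is the limit of difference quotients along the steps
1 / (k + 1), which are measurable by the previous lemma. *)
Lemma measurable_fun_partial d d' (T : measurableType d)
    (Xi : measurableType d') (R : realType) n (g : 'rV[R]_n -> Xi -> R)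
    (X : T -> 'rV[R]_n) (Z : T -> Xi) (i : 'I_n) :
  (forall s x, differentiable (g^~ s) x) ->
  (forall x, measurable_fun [set: Xi] (g x)) ->
  (forall i, measurable_fun [set: T] (fun w => X w 0 i)) ->
  measurable_fun [set: T] Z ->
  measurable_fun [set: T] (fun w => partial (g^~ (Z w)) i (X w)).
Proof.
move=> gd gm mX mZ.
have gc s : continuous (g^~ s).
  by move=> x; apply: differentiable_continuous; exact: gd.
pose dq (k : nat) w : R := (harmonic k)^-1 *
  (g (harmonic k *: delta_mx 0 i + X w) (Z w) - g (X w) (Z w)).
apply: (@measurable_fun_cvg _ _ _ _ dq).
  move=> k; apply: measurable_funM => //; apply: measurable_funB.
    apply: measurable_fun_caratheodory => // j.
    have -> : (fun w => (harmonic k *: delta_mx 0 i + X w) 0 j) =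
        (fun w => (harmonic k *: delta_mx 0 i : 'rV[R]_n) 0 j + X w 0 j).
      by apply/funext => w; rewrite mxE.
    exact: measurable_funD.
  exact: measurable_fun_caratheodory.
move=> w _.
have /cvg_ex[l hl] : derivable (g^~ (Z w)) (X w) (delta_mx 0 i).
  by apply: diff_derivable; exact: gd.
rewrite /partial /derive (cvg_lim _ hl)//.
have /cvgr_dnbhsP := hl.
apply; split; last exact: cvg_harmonic.
by move=> k; rewrite gt_eqF// harmonic_gt0.
Qed.

Lemma measurable_fun_sqrt d (T : measurableType d) (R : realType) (h : T -> R) :
  measurable_fun [set: T] h ->
  measurable_fun [set: T] (fun w => Num.sqrt (h w)).
Proof.
apply: measurableT_comp.
by apply: continuous_measurable_fun; exact: sqrt_continuous.
Qed.

Lemma measurable_fun_inv d (T : measurableType d) (R : realType) (h : T -> R) :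
  (forall w, 0 < h w) -> measurable_fun [set: T] h ->
  measurable_fun [set: T] (fun w => (h w)^-1).
Proof.
move=> h0 mh.
have -> : (fun w => (h w)^-1) = (fun w => h w `^ (-1)).
  by apply/funext => w; rewrite powR_inv1// ltW.
exact: (measurableT_comp (measurable_powR (-1)) mh).
Qed.

(** By induction on t: v_t is obtained by substituting theta_t and xi_t in the
objective and its partial derivatives, and the updates are rational functions
of v_t and the current state with positive denominators. *)
Lemma aegdm_measurable d d' (T : measurableType d) (Xi : measurableType d')
    (R : realType) n (f : 'rV[R]_n -> Xi -> R) (c eta mu : R)
    (theta0 : 'rV[R]_n) (xis : nat -> T -> Xi)
    (theta r m v : nat -> T -> 'rV[R]_n) :
  (forall s x, differentiable (fun y => f y s) x) ->
  (forall x s, 0 < f x s + c) ->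
  (forall x, measurable_fun [set: Xi] (f x)) ->
  (forall t, measurable_fun [set: T] (xis t)) ->
  0 < eta ->
  (forall w, aegdm (fun t x => f x (xis t w)) c eta mu theta0
     (fun t => theta t w) (fun t => r t w) (fun t => m t w) (fun t => v t w)) ->
  forall t i, [/\ measurable_fun [set: T] (fun w => theta t w 0 i),
    measurable_fun [set: T] (fun w => r t w 0 i),
    measurable_fun [set: T] (fun w => m t w 0 i)
  & measurable_fun [set: T] (fun w => v t w 0 i)].
Proof.
move=> fd fpos fm mxi e0 run.
have mv t : (forall i, measurable_fun [set: T] (fun w => theta t w 0 i)) ->
    forall i, measurable_fun [set: T] (fun w => v t w 0 i).
  move=> mth i; under eq_fun do rewrite (aegdm_v (run _)).
  apply: measurable_funM; first exact: measurable_fun_partial.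
  apply: measurable_fun_inv.
    by move=> w; rewrite mulr_gt0 ?sqrtr_gt0.
  apply: measurable_funM => //; apply: measurable_fun_sqrt.
  apply: measurable_funD => //.
  apply: measurable_fun_caratheodory => //.
  by move=> s x; apply: differentiable_continuous; exact: fd.
suff H t : forall i, [/\ measurable_fun [set: T] (fun w => theta t w 0 i),
    measurable_fun [set: T] (fun w => r t w 0 i)
  & measurable_fun [set: T] (fun w => m t w 0 i)].
  move=> t i; have [mth mr mm] := H t i; split=> //.
  by apply: mv => j; have [] := H t j.
elim: t => [|t IH] i.
  split.
  - under eq_fun do rewrite (aegdm_theta0 (run _)).
    exact: measurable_cst.
  - under eq_fun do rewrite (aegdm_r0 (run _)).
    apply: measurable_fun_sqrt; apply: measurable_funD => //.
    exact: measurableT_comp.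
  - under eq_fun do rewrite (aegdm_m0 (run _)).
    exact: measurable_cst.
have mvt := mv t (fun j => let: And3 h _ _ := IH j in h).
have [mth mr mm] := IH i.
have mr1 : measurable_fun [set: T] (fun w => r t.+1 w 0 i).
  under eq_fun do rewrite (aegdm_rS (run _)).
  apply: measurable_funM => //; apply: measurable_fun_inv.
    by move=> w; exact: lt_le_trans ltr01 (energy_factor_ge1 _ e0).
  apply: measurable_funD => //; apply: measurable_funM => //.
  exact: measurable_funX.
have mm1 : measurable_fun [set: T] (fun w => m t.+1 w 0 i).
  under eq_fun do rewrite (aegdm_mS (run _)).
  by apply: measurable_funD => //; exact: measurable_funM.
split=> //.
under eq_fun do rewrite (aegdm_thetaS (run _)).
apply: measurable_funB => //; apply: measurable_funM => //.
exact: measurable_funM.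
Qed.

(** * Expectations *)

Lemma expectation_le_ge0 d (T : measurableType d) (R : realType)
    (P : probability T R) (X Y : T -> R) :
  measurable_fun [set: T] X -> measurable_fun [set: T] Y ->
  (forall w, 0 <= X w) -> (forall w, X w <= Y w) -> ('E_P[X] <= 'E_P[Y])%E.
Proof.
move=> mX mY X0 XY; apply: expectation_le => //; last exact: aeW.
by move=> w; apply: le_trans (XY w).
Qed.

(** The difference Y - X is nonnegative, and a nonnegative function with zero
integral vanishes almost everywhere.  Finiteness of the larger expectation
allows cancelling. *)
Lemma expectation_lt d (T : measurableType d) (R : realType)
    (P : probability T R) (X Y : T -> R) :
  measurable_fun [set: T] X -> measurable_fun [set: T] Y ->
  (forall w, 0 <= X w) -> (forall w, X w <= Y w) ->
  ('E_P[Y] < +oo)%E -> ~ {ae P, forall w, X w = Y w} -> ('E_P[X] < 'E_P[Y])%E.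
Proof.
move=> mX mY X0 XY Yoo nXY.
have mD : measurable_fun [set: T] (fun w => Y w - X w).
  exact: measurable_funB.
have D0 w : 0 <= Y w - X w by rewrite subr_ge0.
have EY : ('E_P[Y] = 'E_P[X] + 'E_P[fun w => (Y w - X w)%R])%E.
  rewrite unlock -ge0_integralD//.
  - by apply: eq_integral => w _; rewrite -EFinD addrC subrK.
  - by move=> w _; rewrite lee_fin.
  - exact/measurable_EFinP.
  - by move=> w _; rewrite lee_fin.
  - exact/measurable_EFinP.
have ED0 : (0 <= 'E_P[fun w => (Y w - X w)%R])%E by exact: expectation_ge0.
have EX : ('E_P[X])%E \is a fin_num.
  rewrite ge0_fin_numE; last exact: expectation_ge0.
  by apply: le_lt_trans Yoo; exact: expectation_le_ge0.
rewrite EY lteDl// lt0e ED0 andbT; apply: contra_notN nXY => /eqP h.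
have mDE : measurable_fun [set: T] (fun w => (Y w - X w)%:E).
  exact/measurable_EFinP.
have : (\int[P]_(w in [set: T]) `|(Y w - X w)%:E| = 0)%E.
  rewrite -[RHS]h unlock; apply: eq_integral => w _.
  by rewrite gee0_abs// lee_fin.
move/(ae_eq_integral_abs P measurableT mDE).
by apply: filterS => w /(_ Logic.I) [] /eqP; rewrite subr_eq0 => /eqP ->.
Qed.

(** Cauchy-Schwarz, with the square roots written out so that the expectations
on the right may be infinite. *)
Lemma expectation_sqrtM d (T : measurableType d) (R : realType)
    (P : probability T R) (X Y : T -> R) :
  measurable_fun [set: T] X -> measurable_fun [set: T] Y ->
  (forall w, 0 <= X w) -> (forall w, 0 <= Y w) ->
  ('E_P[fun w => (Num.sqrt (X w) * Num.sqrt (Y w))%R] <=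
     poweR 'E_P[X] 2^-1 * poweR 'E_P[Y] 2^-1)%E.
Proof.
move=> mX mY X0 Y0.
have h2 : (2^-1 + 2^-1 = 1 :> R) by lra.
have := hoelder P (measurable_fun_sqrt mX) (measurable_fun_sqrt mY)
  (ltr0Sn _ 1) (ltr0Sn _ 1) h2.
have N2 (Z : T -> R) : (forall w, 0 <= Z w) ->
    Lnorm P 2%:E (EFin \o (fun w => Num.sqrt (Z w))) = poweR ('E_P[Z])%E 2^-1.
  move=> Z0; rewrite unlock expectation.unlock; congr poweR.
  apply: eq_integral => w _ /=.
  by rewrite ger0_norm ?sqrtr_ge0// powR_mulrn ?sqrtr_ge0// sqr_sqrtr.
rewrite !N2// Lnorm1; apply: le_trans.
rewrite unlock le_eqVlt; apply/orP; left; apply/eqP.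
by apply: eq_integral => w _ /=; rewrite ger0_norm// mulr_ge0 ?sqrtr_ge0.
Qed.

Lemma expectation_sqrt_le d (T : measurableType d) (R : realType)
    (P : probability T R) (X : T -> R) :
  measurable_fun [set: T] X -> (forall w, 0 <= X w) ->
  ('E_P[fun w => Num.sqrt (X w)] <= poweR 'E_P[X] 2^-1)%E.
Proof.
move=> mX X0.
have := @expectation_sqrtM _ _ _ P X (cst 1) mX (measurable_cst _) X0
  (fun=> ler01).
rewrite expectation_cst poweR1r mule1.
by under eq_fun do rewrite sqrtr1 mulr1.
Qed.

Lemma expectation_eq_distribution d d' (T : measurableType d)
    (Xi : measurableType d') (R : realType) (P : probability T R)
    (X Y : {RV P >-> Xi}) (h : Xi -> R) :
  (forall A, measurable A -> distribution P X A = distribution P Y A) ->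
  measurable_fun [set: Xi] h -> (forall s, 0 <= h s) ->
  ('E_P[fun w => h (X w)] = 'E_P[fun w => h (Y w)])%E.
Proof.
move=> XY mh h0; rewrite unlock.
have mhE : measurable_fun [set: Xi] (EFin \o h) by exact/measurable_EFinP.
have h0E s : (0 <= (EFin \o h) s)%E by rewrite lee_fin.
rewrite -[LHS](ge0_integral_distribution X mhE h0E).
rewrite -[RHS](ge0_integral_distribution Y mhE h0E).
by apply: eq_measure_integral => A mA _; exact: XY.
Qed.

Lemma expectation_sum_ge0 d (T : measurableType d) (R : realType)
    (P : probability T R) (X : nat -> T -> R) N :
  (forall t, measurable_fun [set: T] (X t)) -> (forall t w, 0 <= X t w) ->
  ('E_P[fun w => (\sum_(0 <= t < N) X t w)%R] = \sum_(0 <= t < N) 'E_P[X t])%E.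
Proof.
move=> mX X0; rewrite unlock.
rewrite -(@ge0_integral_sum _ _ _ P _ measurableT _ (fun t w => (X t w)%:E)).
- by apply: eq_integral => w _; rewrite sumEFin.
- by move=> t; exact/measurable_EFinP.
- by move=> t w _; rewrite lee_fin.
Qed.

Lemma expectationZl_ge0 d (T : measurableType d) (R : realType)
    (P : probability T R) (k : R) (X : T -> R) :
  0 <= k -> measurable_fun [set: T] X -> (forall w, 0 <= X w) ->
  ('E_P[fun w => (k * X w)%R] = k%:E * 'E_P[X])%E.
Proof.
move=> k0 mX X0; rewrite unlock -ge0_integralZl_EFin//.
- by move=> w _; rewrite lee_fin.
- exact/measurable_EFinP.
Qed.

(** Each term is bounded by the tail of the series that it starts. *)
Lemma cvg_nneseries_bounded (R : realType) (b : nat -> \bar R) (C : R) :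
  (forall t, (0 <= b t)%E) ->
  (\sum_(0 <= t <oo) b t <= C%:E)%E ->
  b t @[t --> \oo] --> 0%E.
Proof.
move=> b0 bC.
have tail : (\sum_(N <= k <oo) b k)%E @[N --> \oo] --> 0%E.
  by apply: nneseries_tail_cvg => //; exact: le_lt_trans bC (ltry _).
apply: squeeze_cvge (cvg_cst 0%E) tail.
apply: nearW => N; rewrite b0 /=.
have := @nneseries_lim_ge R b xpredT N N.+1 (fun t _ _ => b0 t).
by rewrite big_nat1.
Qed.

(** Convergence to 0 in mean square implies convergence in mean, since
E X <= (E X^2)^(1/2). *)
Lemma cvg_expectation_of_sqr d (T : measurableType d) (R : realType)
    (P : probability T R) (X : nat -> T -> R) :
  (forall t, measurable_fun [set: T] (X t)) -> (forall t w, 0 <= X t w) ->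
  'E_P[fun w => (X t w ^+ 2)%R]%E @[t --> \oo] --> 0%E ->
  'E_P[X t]%E @[t --> \oo] --> 0%E.
Proof.
move=> mX X0 cX2.
have ub t : ('E_P[X t] <= poweR 'E_P[fun w => (X t w ^+ 2)%R] 2^-1)%E.
  have := expectation_sqrt_le P (measurable_funX 2 (mX t))
    (fun w => sqr_ge0 (X t w)).
  by under eq_fun do rewrite sqrtr_sqr ger0_norm//.
have /fine_cvgP[fin_a cvg_a] := cX2.
have cvg_sqrt : (Num.sqrt (fine ('E_P[fun w => (X t w ^+ 2)%R])%E))%:E
    @[t --> \oo] --> 0%E.
  apply: cvg_EFin; first exact: nearW.
  rewrite -[X in _ --> X]sqrtr0.
  by apply: (cvg_comp _ _ cvg_a); exact: sqrt_continuous.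
apply: squeeze_cvge (cvg_cst 0%E) cvg_sqrt.
near=> t.
have a0 : (0 <= 'E_P[fun w => (X t w ^+ 2)%R])%E.
  by apply: expectation_ge0 => w; exact: sqr_ge0.
have finE : ('E_P[fun w => (X t w ^+ 2)%R])%E \is a fin_num by near: t.
rewrite expectation_ge0//=; apply: le_trans (ub t) _.
by rewrite -{1}(fineK finE) poweR_EFin powR12_sqrt// fine_ge0.
Unshelve. all: by end_near.
Qed.

(** * Energy stability of the stochastic method *)

Lemma sqr_enorm (R : realType) n (x : 'rV[R]_n) :
  enorm x ^+ 2 = \sum_(i < n) x 0 i ^+ 2.
Proof. by rewrite sqr_sqrtr// sumr_ge0// => i _; exact: sqr_ge0. Qed.

Lemma enorm_eq_sqrt_sqr (R : realType) n (x : 'rV[R]_n) :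
  enorm x = Num.sqrt (enorm x ^+ 2).
Proof. by rewrite sqr_enorm. Qed.

Theorem theorem4p5 (R : realType) (d d' : measure_display)
    (Om : measurableType d) (Xi : measurableType d') (P : probability Om R)
    (n : nat) (f : 'rV[R]_n -> Xi -> R) (c : R)
    (xi : {RV P >-> Xi}) (xis : nat -> {RV P >-> Xi})
    (eta mu : R) (theta0 : 'rV[R]_n) (theta r m v : nat -> Om -> 'rV[R]_n)
    (f_diff : forall s x, differentiable (fun y => f y s) x)
    (f_bounded : forall s, has_lbound (range (fun y => f y s)))
    (f_pos : forall x s, 0 < f x s + c)
    (f_meas : forall x, measurable_fun [set: Xi] (f x))
    (f_int : forall x, P.-integrable [set: Om] (fun w => (f x (xi w))%:E))
    (xis_distr : forall t A, measurable A ->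
       distribution P (xis t) A = distribution P xi A)
    (eta_gt0 : 0 < eta)
    (run : forall w, aegdm (fun t x => f x (xis t w)) c eta mu theta0
       (fun t => theta t w) (fun t => r t w) (fun t => m t w)
       (fun t => v t w)) :
  [/\ forall i : 'I_n,
        [/\ forall t, ('E_P[fun w => (r t.+1 w 0 i)%R] <=
                       'E_P[fun w => (r t w 0 i)%R])%E,
            (forall t, ~ {ae P, forall w, v t w 0 i = 0} ->
              ('E_P[fun w => (r t.+1 w 0 i)%R] <
               'E_P[fun w => (r t w 0 i)%R])%E)
          & exists ristar : R,
              ('E_P[fun w => (r t w 0 i)%R])%E @[t --> \oo] --> ristar%:E],
      0 <= mu < 1 ->
        ('E_P[fun w => enorm (theta t.+1 w - theta t w)%R])%E @[t --> \oo]
          --> 0%:E /\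
        (\sum_(0 <= t <oo)
            'E_P[fun w => (enorm (theta t.+1 w - theta t w) ^+ 2)%R]
          <= (2 * eta * n%:R / (1 - mu) ^+ 2
              * (mean_objective xi f theta0 + c))%:E)%E
    & forall (N : nat) (i : 'I_n), (1 <= N)%N ->
        ((N%:R^-1)%:E * \sum_(0 <= t < N) 'E_P[fun w => `|(v t w 0 i)%R|%R]
          <= ((Num.sqrt (mean_objective xi f theta0 + c) / 2) `^ 2^-1)%:E
             * poweR 'E_P[fun w => (1 / (eta * N%:R * r N w 0 i))%R] 2^-1)%E ].
Proof.
have xi_meas t : measurable_fun [set: Om] (xis t) by exact: measurable_funPT.
have meas := aegdm_measurable f_diff f_pos f_meas xi_meas eta_gt0 run.
have mr t i : measurable_fun [set: Om] (fun w => r t w 0 i).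
  by have [] := meas t i.
have mv t i : measurable_fun [set: Om] (fun w => v t w 0 i).
  by have [] := meas t i.
have er w i : energy_recursion eta (fun t => v t w 0 i) (fun t => r t w 0 i).
  split=> [|t]; last exact: (aegdm_rS (run w)).
  by rewrite (aegdm_r0 (run w)) sqrtr_gt0.
have r_gt0 t w i : 0 < r t w 0 i by exact: (energy_gt0 t eta_gt0 (er w i)).
have r_le s t w i : (s <= t)%N -> r t w 0 i <= r s w 0 i.
  exact: (energy_nonincreasing eta_gt0 (er w i)).
set F := mean_objective xi f theta0 + c.
pose f0 w := f theta0 (xis 0%N w) + c.
have f0_ge0 w : 0 <= f0 w by exact/ltW/f_pos.
have mf0 : measurable_fun [set: Om] f0.
  by apply: measurable_funD => //; exact: measurableT_comp.
(* The first energy is computed from the sample xi_0, the mean objective from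
   xi: only their common distribution links them. *)
have Ef0 : ('E_P[f0] = F%:E)%E.
  have mh : measurable_fun [set: Xi] (fun s => f theta0 s + c).
    exact: measurable_funD.
  rewrite /f0 (expectation_eq_distribution (xis_distr 0%N) mh)//; last first.
    by move=> s; exact/ltW/f_pos.
  rewrite /F EFinD /mean_objective fineK unlock; last first.
    by apply: integrable_fin_num => //; exact: f_int.
  rewrite -[in RHS](expectation_cst P c) unlock -integralD//.
  exact: finite_measure_integrable_cst.
have F_ge0 : 0 <= F by rewrite -lee_fin -Ef0; exact: expectation_ge0.
have r0E i w : r 0%N w 0 i = Num.sqrt (f0 w) by exact: (aegdm_r0 (run w)).
have Er0 i : ('E_P[fun w => (r 0%N w 0 i)%R] <= (Num.sqrt F)%:E)%E.
  under eq_fun do rewrite r0E.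
  apply: le_trans (expectation_sqrt_le P mf0 f0_ge0) _.
  by rewrite Ef0 poweR_EFin powR12_sqrt.
have Er_fin t i : ('E_P[fun w => (r t w 0 i)%R] < +oo)%E.
  apply: le_lt_trans (ltry (Num.sqrt F)); apply: le_trans (Er0 i).
  apply: expectation_le_ge0 => // w; [exact/ltW/r_gt0|exact: r_le].
have Er_le s t i : (s <= t)%N ->
    ('E_P[fun w => (r t w 0 i)%R] <= 'E_P[fun w => (r s w 0 i)%R])%E.
  move=> st; apply: expectation_le_ge0 => // w; first exact/ltW/r_gt0.
  exact: r_le.
split.
- move=> i; split.
  + by move=> t; exact: Er_le.
  + move=> t nv; apply: expectation_lt => //.
    * by move=> w; exact/ltW/r_gt0.
    * by move=> w; exact: r_le.
    * apply: contra_not nv; apply: filterS => w /eqP.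
      (* The drop 2 eta v_t^2 r_(t+1) vanishes exactly where v_t does. *)
      rewrite eq_sym -subr_eq0 (energy_drop t eta_gt0 (er w i)).
      rewrite !mulf_eq0 (gt_eqF (r_gt0 _ _ _)) orbF (gt_eqF eta_gt0) orbF.
      by rewrite pnatr_eq0 /= orbb => /eqP.
  + set l := ereal_inf (range (fun t => 'E_P[fun w => (r t w 0 i)%R]%E)).
    have l_fin : l \is a fin_num.
      rewrite ge0_fin_numE.
        apply: le_lt_trans (Er_fin 0%N i).
        by apply: ereal_inf_lbound; exists 0%N.
      apply: le_ereal_inf_tmp => _ [t _ <-]; apply: expectation_ge0 => w.
      exact/ltW/r_gt0.
    exists (fine l); rewrite fineK//.
    by apply: ereal_nonincreasing_cvgn => s t st; exact: Er_le.
- move=> mu01.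
  have /andP[_ mu1] := mu01.
  set C := 2 * eta * n%:R / (1 - mu) ^+ 2.
  have C_ge0 : 0 <= C.
    by rewrite divr_ge0 ?exprn_ge0 ?subr_ge0 ?(ltW mu1)// !mulr_ge0// ltW.
  pose a t w := enorm (theta t.+1 w - theta t w) ^+ 2.
  have aE t w : a t w =
      \sum_(i < n) (2 * eta * r t.+1 w 0 i * m t.+1 w 0 i) ^+ 2.
    rewrite /a sqr_enorm; apply: eq_bigr => i _.
    by rewrite !mxE (aegdm_thetaS (run w)) addrAC subrr add0r sqrrN.
  have a_ge0 t w : 0 <= a t w by exact: sqr_ge0.
  have ma t : measurable_fun [set: Om] (a t).
    have -> : a t = fun w =>
        \sum_(i < n) (theta t.+1 w 0 i - theta t w 0 i) ^+ 2.
      apply/funext => w; rewrite /a sqr_enorm.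
      by apply: eq_bigr => i _; rewrite !mxE.
    apply: measurable_sum => i; apply: measurable_funX; apply: measurable_funB.
      by have [] := meas t.+1 i.
    by have [] := meas t i.
  have a_sum N w : \sum_(0 <= t < N) a t w <= C * f0 w.
    under eq_bigr do rewrite aE.
    rewrite exchange_big/=.
    apply: (@le_trans _ _ (\sum_(i < n) 2 * eta / (1 - mu) ^+ 2 * f0 w)).
      apply: ler_sum => i _.
      have := energy_displacement_sum N eta_gt0 mu01 (er w i)
        (aegdm_m0 (run w) i) (fun t => aegdm_mS (run w) t i).
      by rewrite r0E sqr_sqrtr.
    rewrite sumr_const card_ord -mulr_natl /C le_eqVlt; apply/orP; left.
    by apply/eqP; ring.
  have Ea_sum : (\sum_(0 <= t <oo) 'E_P[a t] <= (C * F)%:E)%E.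
    apply: lime_le.
      by apply: is_cvg_nneseries => t _ _; exact: expectation_ge0.
    apply: nearW => N; rewrite -expectation_sum_ge0//.
    rewrite EFinM -Ef0 -expectationZl_ge0//.
    apply: expectation_le_ge0 => //.
    - exact: measurable_sum.
    - exact: measurable_funM.
    - by move=> w; exact: sumr_ge0.
  split=> //.
  apply: cvg_expectation_of_sqr.
  + move=> t; under eq_fun do rewrite enorm_eq_sqrt_sqr.
    exact: (measurable_fun_sqrt (ma t)).
  + by move=> t w; exact: sqrtr_ge0.
  + apply: cvg_nneseries_bounded Ea_sum => t; exact: expectation_ge0.
- move=> N i N1.
  have K0 : 0 < N%:R :> R by rewrite ltr0n.
  have den_gt0 w : 0 < eta * N%:R * r N w 0 i by rewrite !mulr_gt0.
  have mabs t : measurable_fun [set: Om] (fun w => `|v t w 0 i|).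
    exact: measurableT_comp.
  have mX : measurable_fun [set: Om] (fun w => r 0%N w 0 i / 2).
    exact: measurable_funM.
  have mY : measurable_fun [set: Om] (fun w => 1 / (eta * N%:R * r N w 0 i)).
    apply: measurable_funM => //; apply: measurable_fun_inv => //.
    exact: measurable_funM.
  have X_ge0 w : 0 <= r 0%N w 0 i / 2 by rewrite divr_ge0// ltW.
  have Y_ge0 w : 0 <= 1 / (eta * N%:R * r N w 0 i) by rewrite divr_ge0// ltW.
  have mS : measurable_fun [set: Om] (fun w => \sum_(0 <= t < N) `|v t w 0 i|).
    exact: measurable_sum.
  have S_ge0 w : 0 <= \sum_(0 <= t < N) `|v t w 0 i| by exact: sumr_ge0.
  have K1_ge0 : 0 <= N%:R^-1 :> R by rewrite invr_ge0 ltW.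
  rewrite -expectation_sum_ge0// -expectationZl_ge0//.
  apply: (@le_trans _ _ ('E_P[fun w => (Num.sqrt (r 0%N w 0 i / 2) *
      Num.sqrt (1 / (eta * N%:R * r N w 0 i)))%R])%E).
    apply: expectation_le_ge0.
    + exact: measurable_funM.
    + by apply: measurable_funM; exact: measurable_fun_sqrt.
    + by move=> w; rewrite mulr_ge0.
    + by move=> w; exact: (energy_gradient_mean eta_gt0 (er w i) N1).
  apply: le_trans (expectation_sqrtM P mX mY X_ge0 Y_ge0) _.
  apply: lee_wpmul2r; first exact: poweR_ge0.
  rewrite -poweR_EFin gt0_ler_poweR// ?in_itv/= ?leey ?andbT.
  + exact: expectation_ge0.
  + by rewrite lee_fin divr_ge0// sqrtr_ge0.
  + under eq_fun do rewrite mulrC.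
    rewrite expectationZl_ge0// ?invr_ge0//; last by move=> w; exact/ltW/r_gt0.
    rewrite mulrC EFinM; exact: lee_wpmul2l.
Qed.
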